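(* (Type safety of DCC.) If $\Delta;\cdot\vdash M:A$ in DCC, then $\Delta\vdash M\triangleright^* v$ for some irreducible value $v$.
   Context: DCC (Defunctionalized Calculus of Constructions): expressions $A,B,L,M,N::=x\mid U_i\mid\Pi x{:}A.B\mid L@M\mid\ell_i\{\overline M\}$, where $\ell_i$ ($i\in\mathbb N$) are label names disjoint from variables and $\overline M=M_1,\dots,M_n$ ($n\ge0$). Type contexts $\Gamma::=\cdot\mid\Gamma,x{:}A$; label contexts $\Delta::=\cdot\mid\Delta,\ell_i(\{\overline x{:}\overline A\},x{:}A\mapsto M:B)$ recording a free-variable telescope, an argument, a body and a result type. Substitution is standard with $\ell\{\overline M\}[N/x]=\ell\{\overline{M[N/x]}\}$; $[\overline M/\overline x]=[M_1/x_1,\dots,M_n/x_n]$. The only reduction rule: $\Delta\vdash\ell\{\overline M\}@N\triangleright L[\overline M/\overline x,N/x]$ when $\ell(\{\overline x{:}\overline A\},x{:}A\mapsto L:B)\in\Delta$; $\triangleright^*$ is zero or more steps. Equivalence $\Delta\vdash M\equiv N$: common reduct; or $\Delta\vdash L\triangleright^*\ell\{\overline N\}$, $\Delta\vdash M\triangleright^*M'$, $\ell(\{\overline x{:}\overline A\},x{:}A\mapsto N:B)\in\Delta$, $\Delta\vdash N[\overline N/\overline x]\equiv M'@x$ give $\Delta\vdash L\equiv M$; or symmetrically. Typing $\Delta;\Gamma\vdash M:A$ and formation $\vdash\Delta;\Gamma$ (mutual): variables ($x{:}A\in\Gamma$, $\vdash\Delta;\Gamma$), $U_i:U_{i+1}$,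 $\Pi x{:}A.B:U_{\max(i,j)}$ when $A:U_i$ and $B:U_j$ under $x{:}A$, application $M@N:B[N/x]$ when $M:\Pi x{:}A.B$ and $N:A$, conversion along $\equiv$ to a type $B:U_i$, and labels: if $\vdash\Delta;\Gamma$, $\ell(\{\overline x{:}\overline A\},x{:}A\mapsto M:B)\in\Delta$, $|\overline M|=|\overline x|$ and $\Delta;\Gamma\vdash M_k:A_k[M_1/x_1,\dots,M_{k-1}/x_{k-1}]$ for all $k$, then $\Delta;\Gamma\vdash\ell\{\overline M\}:\Pi x{:}A[\overline M/\overline x].B[\overline M/\overline x]$. Formation: $\vdash\cdot;\cdot$; a fresh label entry $\ell(\{\overline x{:}\overline A\},x{:}A\mapsto M:B)$ may be added when $\Delta;\overline x{:}\overline A\vdash\Pi x{:}A.B:U_i$ and $\Delta;\overline x{:}\overline A,x{:}A\vdash M:B$; $\vdash\Delta;\Gamma$ and $\Delta;\Gamma\vdash A:U_i$ give $\vdash\Delta;\Gamma,x{:}A$. *)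

(* Defs.v *)
From Stdlib Require Import List Arith.
Import ListNotations.

(* Expressions: x | U_i | Pi x:A.B | L@M | l_i{M1,...,Mn}.
   Variables are de Bruijn indices; in [pi A B], index 0 of B is the bound x. *)
Inductive term : Type :=
| var (n : nat)
| univ (i : nat)
| pi (A B : term)
| app (M N : term)
| lab (l : nat) (Ms : list term).

Definition uprn (xi : nat -> nat) : nat -> nat :=
  fun n => match n with 0 => 0 | S n => S (xi n) end.

Fixpoint ren (xi : nat -> nat) (t : term) : term :=
  match t with
  | var n => var (xi n)
  | univ i => univ i
  | pi A B => pi (ren xi A) (ren (uprn xi) B)
  | app M N => app (ren xi M) (ren xi N)
  | lab l Ms => lab l (map (ren xi) Ms)
  end.

Definition lift (t : term) : term := ren S t.

Definition up (sigma : nat -> term) : nat -> term :=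
  fun n => match n with 0 => var 0 | S n => lift (sigma n) end.

Fixpoint subst (sigma : nat -> term) (t : term) : term :=
  match t with
  | var n => sigma n
  | univ i => univ i
  | pi A B => pi (subst sigma A) (subst (up sigma) B)
  | app M N => app (subst sigma M) (subst sigma N)
  | lab l Ms => lab l (map (subst sigma) Ms)
  end.

Definition subst1 (N : term) : nat -> term :=
  fun j => match j with 0 => N | S j => var j end.

(* Substitution closing a telescope x_1,...,x_n (x_n = index 0) by
   [M_1/x_1,...,M_n/x_n], where Ms = [M_1;...;M_n]. *)
Definition tele_sub (Ms : list term) : nat -> term :=
  fun j => if j <? length Ms then nth (length Ms - 1 - j) Ms (var 0)
           else var (j - length Ms).

(* Label entry l({x_1:A_1,...,x_n:A_n}, x:A |-> M : B).
   e_tele = [A_1;...;A_n] (A_k lives in context x_1..x_{k-1});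
   e_arg = A and the type Pi x:A.B live in context x_1..x_n;
   e_body = M and e_res = B live in context x_1..x_n, x (x = index 0). *)
Record entry := mkEntry {
  e_name : nat;
  e_tele : list term;
  e_arg : term;
  e_body : term;
  e_res : term }.

Definition lctx := list entry.   (* newest entry at the head *)
Definition ctx := list term.     (* newest binding at the head *)

Definition fresh (l : nat) (D : lctx) : Prop :=
  forall e, In e D -> e_name e <> l.

Inductive step (D : lctx) : term -> term -> Prop :=
| st_beta e Ms N :
    In e D -> length Ms = length (e_tele e) ->
    step D (app (lab (e_name e) Ms) N) (subst (tele_sub (Ms ++ [N])) (e_body e))
| st_piL A A' B : step D A A' -> step D (pi A B) (pi A' B)
| st_piR A B B' : step D B B' -> step D (pi A B) (pi A B')
| st_appL M M' N : step D M M' -> step D (app M N) (app M' N)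
| st_appR M N N' : step D N N' -> step D (app M N) (app M N')
| st_lab l Ms1 M M' Ms2 :
    step D M M' -> step D (lab l (Ms1 ++ M :: Ms2)) (lab l (Ms1 ++ M' :: Ms2)).

Inductive reds (D : lctx) : term -> term -> Prop :=
| reds_refl M : reds D M M
| reds_step M N L : step D M N -> reds D N L -> reds D M L.

Inductive equiv (D : lctx) : term -> term -> Prop :=
| eq_red M N L : reds D M L -> reds D N L -> equiv D M N
| eq_etaL L M Ns M' e :
    reds D L (lab (e_name e) Ns) -> reds D M M' -> In e D ->
    length Ns = length (e_tele e) ->
    equiv D (subst (up (tele_sub Ns)) (e_body e)) (app (lift M') (var 0)) ->
    equiv D L M
| eq_etaR L M Ns M' e :
    reds D L (lab (e_name e) Ns) -> reds D M M' -> In e D ->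
    length Ns = length (e_tele e) ->
    equiv D (subst (up (tele_sub Ns)) (e_body e)) (app (lift M') (var 0)) ->
    equiv D M L.

Inductive has_type : lctx -> ctx -> term -> term -> Prop :=
| ty_var D G n A :
    nth_error G n = Some A -> wf D G ->
    has_type D G (var n) (ren (Nat.add (S n)) A)
| ty_univ D G i : wf D G -> has_type D G (univ i) (univ (S i))
| ty_pi D G A B i j :
    has_type D G A (univ i) -> has_type D (A :: G) B (univ j) ->
    has_type D G (pi A B) (univ (Nat.max i j))
| ty_app D G M N A B :
    has_type D G M (pi A B) -> has_type D G N A ->
    has_type D G (app M N) (subst (subst1 N) B)
| ty_conv D G M A B i :
    has_type D G M A -> equiv D A B -> has_type D G B (univ i) ->
    has_type D G M B
| ty_lab D G e Ms :
    wf D G -> In e D -> length Ms = length (e_tele e) ->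
    (forall k, k < length Ms ->
       has_type D G (nth k Ms (var 0))
         (subst (tele_sub (firstn k Ms)) (nth k (e_tele e) (var 0)))) ->
    has_type D G (lab (e_name e) Ms)
      (pi (subst (tele_sub Ms) (e_arg e)) (subst (up (tele_sub Ms)) (e_res e)))
with wf : lctx -> ctx -> Prop :=
| wf_nil : wf [] []
| wf_lab D e i :
    fresh (e_name e) D ->
    has_type D (rev (e_tele e)) (pi (e_arg e) (e_res e)) (univ i) ->
    has_type D (e_arg e :: rev (e_tele e)) (e_body e) (e_res e) ->
    wf (e :: D) []
| wf_cons D G A i : wf D G -> has_type D G A (univ i) -> wf D (A :: G).

Inductive value : term -> Prop :=
| v_univ i : value (univ i)
| v_pi A B : value (pi A B)
| v_lab l Ms : value (lab l Ms).

Definition irreducible (D : lctx) (M : term) : Prop :=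
  forall M', ~ step D M M'.

(* Main.v *)
(** Every type [A] of level [i] is interpreted by a set of normalizing terms,
    by recursion on the universe level and, within a level, by an inductive
    relation [interp D i A P]: neutral types denote the terms reducing to a
    neutral one, [pi] types denote dependent function spaces, and [univ j] the
    terms interpretable at level [j < i]; the relation is closed under
    expansion of [A].  Confluence makes it functional and invariant under
    reduction.  A label entry is typed before it enters the label context, so
    well-typed terms inhabit their interpretation by induction on derivations.
    Normal forms are values or have a variable at the head; a closed one is
    therefore a value. *)

From Stdlib Require Import List Arith Lia.
From Stdlib Require Import FunctionalExtensionality PropExtensionality.
Require Import Defs.
Import ListNotations.

(** The automatic principle gives no hypothesis for the terms captured by a label. The inner
    induction on the list supplies them as a [Forall]. *)
Lemma term_nested_ind (P : term -> Prop) :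
  (forall n, P (var n)) -> (forall i, P (univ i)) ->
  (forall A B, P A -> P B -> P (pi A B)) ->
  (forall M N, P M -> P N -> P (app M N)) ->
  (forall l Ms, Forall P Ms -> P (lab l Ms)) ->
  forall t, P t.
Proof.
  intros Hvar Huniv Hpi Happ Hlab.
  fix IH 1; intros [n | i | A B | M N | l Ms].
  - apply Hvar.
  - apply Huniv.
  - apply Hpi; apply IH.
  - apply Happ; apply IH.
  - apply Hlab; induction Ms; constructor; auto.
Qed.

(** * Renaming and substitution *)

Lemma ren_as_subst xi t : ren xi t = subst (fun n => var (xi n)) t.
Proof.
  revert xi; induction t as [n | i | A B IHA IHB | M N IHM IHN | l Ms IH]
    using term_nested_ind; intros xi; simpl; f_equal; auto.
  - rewrite IHB; f_equal; extensionality n; destruct n; reflexivity.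
  - apply map_ext_Forall; revert IH; apply Forall_impl; auto.
Qed.

Lemma subst_ren sigma xi t :
  subst sigma (ren xi t) = subst (fun n => sigma (xi n)) t.
Proof.
  revert sigma xi; induction t as [n | i | A B IHA IHB | M N IHM IHN | l Ms IH]
    using term_nested_ind; intros sigma xi; simpl; f_equal; auto.
  - rewrite IHB; f_equal; extensionality n; destruct n; reflexivity.
  - rewrite map_map; apply map_ext_Forall; revert IH; apply Forall_impl; auto.
Qed.

Lemma ren_ren xi zeta t : ren xi (ren zeta t) = ren (fun n => xi (zeta n)) t.
Proof. rewrite ren_as_subst, subst_ren, ren_as_subst; reflexivity. Qed.

(** Composition with renamings comes before composition of substitutions, since [up] itself renames
    when it passes a binder. *)
Lemma ren_subst xi sigma t :
  ren xi (subst sigma t) = subst (fun n => ren xi (sigma n)) t.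
Proof.
  revert sigma xi; induction t as [n | i | A B IHA IHB | M N IHM IHN | l Ms IH]
    using term_nested_ind; intros sigma xi; simpl; f_equal; auto.
  - rewrite IHB; f_equal; extensionality n; destruct n; simpl; [reflexivity|].
    unfold lift; rewrite !ren_ren; reflexivity.
  - rewrite map_map; apply map_ext_Forall; revert IH; apply Forall_impl; auto.
Qed.

Lemma up_comp sigma tau :
  (fun n => subst (up tau) (up sigma n)) = up (fun n => subst tau (sigma n)).
Proof.
  extensionality n; destruct n; simpl; [reflexivity|].
  unfold lift; rewrite subst_ren, ren_subst; reflexivity.
Qed.

Lemma subst_subst tau sigma t :
  subst tau (subst sigma t) = subst (fun n => subst tau (sigma n)) t.
Proof.
  revert sigma tau; induction t as [n | i | A B IHA IHB | M N IHM IHN | l Ms IH]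
    using term_nested_ind; intros sigma tau; simpl; f_equal; auto.
  - rewrite IHB, up_comp; reflexivity.
  - rewrite map_map; apply map_ext_Forall; revert IH; apply Forall_impl; auto.
Qed.

Lemma subst_var t : subst var t = t.
Proof.
  induction t as [n | i | A B IHA IHB | M N IHM IHN | l Ms IH]
    using term_nested_ind; simpl; f_equal; auto.
  - replace (up var) with var; [exact IHB|].
    extensionality n; destruct n; reflexivity.
  - induction IH; simpl; f_equal; auto.
Qed.

(** Extends an environment by a value for the newest variable; [subst1 a] is the case where [sigma]
    is [var]. *)
Definition scons (a : term) (sigma : nat -> term) : nat -> term :=
  fun n => match n with 0 => a | S n => sigma n end.

Lemma subst1_up a sigma t :
  subst (subst1 a) (subst (up sigma) t) = subst (scons a sigma) t.
Proof.
  rewrite subst_subst; f_equal; extensionality n; destruct n; simpl; [reflexivity|].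
  unfold lift; rewrite subst_ren; apply subst_var.
Qed.

Lemma subst_subst1 sigma a t :
  subst sigma (subst (subst1 a) t) = subst (scons (subst sigma a) sigma) t.
Proof.
  rewrite subst_subst; f_equal; extensionality n; destruct n; reflexivity.
Qed.

(** * Scoping *)

Inductive scoped : nat -> term -> Prop :=
| sc_var n x : x < n -> scoped n (var x)
| sc_univ n i : scoped n (univ i)
| sc_pi n A B : scoped n A -> scoped (S n) B -> scoped n (pi A B)
| sc_app n M N : scoped n M -> scoped n N -> scoped n (app M N)
| sc_lab n l Ms : Forall (scoped n) Ms -> scoped n (lab l Ms).

(** Allows substitutions built from telescopes to be compared only on the variables of the
    telescope. *)
Lemma subst_scoped_ext n sigma tau t :
  scoped n t -> (forall x, x < n -> sigma x = tau x) ->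
  subst sigma t = subst tau t.
Proof.
  revert n sigma tau; induction t as [x | i | A B IHA IHB | M N IHM IHN | l Ms IH]
    using term_nested_ind; intros n sigma tau Ht Heq; inversion Ht; subst; simpl;
    f_equal; eauto.
  - eapply IHB; [eassumption|].
    intros [|x] Hx; simpl; [reflexivity|]; rewrite Heq; [reflexivity|lia].
  - apply map_ext_in; intros M HM.
    rewrite Forall_forall in *; eauto.
Qed.

Lemma scoped_ren n m xi t :
  scoped n t -> (forall x, x < n -> xi x < m) -> scoped m (ren xi t).
Proof.
  revert n m xi; induction t as [x | i | A B IHA IHB | M N IHM IHN | l Ms IH]
    using term_nested_ind; intros n m xi Ht Hxi; inversion Ht; subst; simpl;
    constructor; eauto.
  - eapply IHB; [eassumption|].
    intros [|x] Hx; simpl; [lia|]; specialize (Hxi x); lia.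
  - rewrite Forall_map, Forall_forall in *; eauto.
Qed.

Lemma scoped_subst n m sigma t :
  scoped n t -> (forall x, x < n -> scoped m (sigma x)) -> scoped m (subst sigma t).
Proof.
  revert n m sigma; induction t as [x | i | A B IHA IHB | M N IHM IHN | l Ms IH]
    using term_nested_ind; intros n m sigma Ht Hsigma; inversion Ht; subst; simpl;
    try constructor; eauto.
  - eapply IHB; [eassumption|].
    intros [|x] Hx; simpl; [constructor; lia|].
    apply scoped_ren with m; [apply Hsigma; lia | lia].
  - rewrite Forall_map, Forall_forall in *; eauto.
Qed.

(** * Telescope substitutions and closed label entries *)

Lemma tele_sub_lt Ms j :
  j < length Ms -> tele_sub Ms j = nth (length Ms - 1 - j) Ms (var 0).
Proof. intros Hj; unfold tele_sub; apply Nat.ltb_lt in Hj; rewrite Hj; reflexivity. Qed.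

Lemma tele_sub_map f Ms j :
  j < length Ms -> tele_sub (map f Ms) j = f (tele_sub Ms j).
Proof.
  intros Hj; rewrite !tele_sub_lt; rewrite ?length_map; try assumption.
  rewrite nth_indep with (d' := f (var 0)) by (rewrite length_map; lia).
  apply map_nth.
Qed.

(** The last term of the list is the value of index 0, so appending an argument at the end is a cons
    on the environment. *)
Lemma tele_sub_snoc Ms N j :
  j <= length Ms -> tele_sub (Ms ++ [N]) j = scons N (tele_sub Ms) j.
Proof.
  intros Hj; rewrite tele_sub_lt; rewrite length_app; simpl; [|lia].
  destruct j as [|j]; simpl.
  - rewrite app_nth2, Nat.add_sub, Nat.sub_0_r, Nat.sub_diag; [reflexivity|lia].
  - rewrite tele_sub_lt, app_nth1 by lia; f_equal; lia.
Qed.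

(* Without scoping this fails: [tele_sub Ms] sends the variables beyond the
   telescope to variables on which [sigma] would still act. *)
Lemma subst_tele_sub n sigma Ms t :
  scoped n t -> length Ms = n ->
  subst sigma (subst (tele_sub Ms) t) = subst (tele_sub (map (subst sigma) Ms)) t.
Proof.
  intros Ht Hn; rewrite subst_subst; apply subst_scoped_ext with n; [assumption|].
  intros x Hx; rewrite tele_sub_map by lia; reflexivity.
Qed.

Lemma scoped_tele_sub n m Ms t :
  scoped n t -> length Ms = n -> Forall (scoped m) Ms -> scoped m (subst (tele_sub Ms) t).
Proof.
  intros Ht Hn HMs; apply scoped_subst with n; [assumption|].
  intros x Hx; rewrite tele_sub_lt by lia.
  rewrite Forall_forall in HMs; apply HMs, nth_In; lia.
Qed.

Record entry_scoped (e : entry) : Prop := {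
  tele_scoped : forall k, k < length (e_tele e) -> scoped k (nth k (e_tele e) (var 0));
  arg_scoped : scoped (length (e_tele e)) (e_arg e);
  body_scoped : scoped (S (length (e_tele e))) (e_body e);
  res_scoped : scoped (S (length (e_tele e))) (e_res e) }.

(** What the theory of reduction takes from well-formedness: closed entries make steps stable under
    substitution, and unique names make reduction confluent. *)
Record coherent (D : lctx) : Prop := {
  entries_scoped : forall e, In e D -> entry_scoped e;
  name_inj : forall e e', In e D -> In e' D -> e_name e = e_name e' -> e = e' }.

(** The body has no variables besides the telescope and the argument, so [sigma] acts only on the
    terms put in their place. *)
Lemma beta_subst D e sigma Ms N :
  coherent D -> In e D -> length Ms = length (e_tele e) ->
  subst sigma (subst (tele_sub (Ms ++ [N])) (e_body e)) =
  subst (tele_sub (map (subst sigma) Ms ++ [subst sigma N])) (e_body e).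
Proof.
  intros HD He Hlen.
  rewrite subst_tele_sub with (n := S (length (e_tele e))).
  - rewrite map_app; reflexivity.
  - apply body_scoped; apply HD; assumption.
  - rewrite length_app; simpl; lia.
Qed.

Lemma beta_ren D e xi Ms N :
  coherent D -> In e D -> length Ms = length (e_tele e) ->
  ren xi (subst (tele_sub (Ms ++ [N])) (e_body e)) =
  subst (tele_sub (map (ren xi) Ms ++ [ren xi N])) (e_body e).
Proof.
  intros HD He Hlen.
  rewrite ren_as_subst, (ren_as_subst xi N), (map_ext _ _ (ren_as_subst xi)).
  eapply beta_subst; eassumption.
Qed.

(** * Reduction *)

Lemma reds_one D M N : step D M N -> reds D M N.
Proof. intros H; eapply reds_step; [exact H | apply reds_refl]. Qed.

Lemma reds_trans D M N L : reds D M N -> reds D N L -> reds D M L.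
Proof. induction 1; intros; [assumption | econstructor; eauto]. Qed.

Lemma reds_cong D (f : term -> term) M N :
  (forall M N, step D M N -> step D (f M) (f N)) -> reds D M N -> reds D (f M) (f N).
Proof. intros Hf; induction 1; econstructor; eauto. Qed.

Lemma reds_app D M M' N N' :
  reds D M M' -> reds D N N' -> reds D (app M N) (app M' N').
Proof.
  intros HM HN; apply reds_trans with (app M' N).
  - apply reds_cong with (f := fun M => app M N); [constructor; assumption | assumption].
  - apply reds_cong; [constructor; assumption | assumption].
Qed.

Lemma reds_pi D A A' B B' :
  reds D A A' -> reds D B B' -> reds D (pi A B) (pi A' B').
Proof.
  intros HA HB; apply reds_trans with (pi A' B).
  - apply reds_cong with (f := fun A => pi A B); [constructor; assumption | assumption].
  - apply reds_cong; [constructor; assumption | assumption].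
Qed.

Lemma reds_lab D l Ms Ms' :
  Forall2 (reds D) Ms Ms' -> reds D (lab l Ms) (lab l Ms').
Proof.
  intros HMs.
  (* The list is reduced from left to right; [Ls] is the prefix already treated. *)
  enough (H : forall Ls, reds D (lab l (Ls ++ Ms)) (lab l (Ls ++ Ms')))
    by exact (H []).
  induction HMs as [|M M' Ms Ms' HM HMs IH]; intros Ls; [constructor|].
  apply reds_trans with (lab l (Ls ++ M' :: Ms)).
  - apply reds_cong with (f := fun M => lab l (Ls ++ M :: Ms));
      [constructor; assumption | assumption].
  - specialize (IH (Ls ++ [M'])); rewrite <- !app_assoc in IH; exact IH.
Qed.

Lemma step_subst D sigma M N :
  coherent D -> step D M N -> step D (subst sigma M) (subst sigma N).
Proof.
  intros HD H; revert sigma; induction H; intros sigma; simpl;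
    rewrite ?map_app; simpl; try (constructor; auto; fail).
  erewrite beta_subst by eassumption.
  constructor; [assumption | rewrite length_map; assumption].
Qed.

Lemma reds_subst D sigma M N :
  coherent D -> reds D M N -> reds D (subst sigma M) (subst sigma N).
Proof. intros HD; apply reds_cong; intros; apply step_subst; assumption. Qed.

Lemma step_scoped D n M N :
  coherent D -> step D M N -> scoped n M -> scoped n N.
Proof.
  intros HD H; revert n; induction H; intros n Hn; inversion Hn; subst;
    try (constructor; auto; fail).
  - match goal with H : scoped _ (lab _ _) |- _ => inversion H; subst end.
    eapply scoped_tele_sub.
    + apply body_scoped; apply HD; assumption.
    + rewrite length_app; simpl; lia.
    + apply Forall_app; auto.
  - constructor; match goal with H : Forall _ _ |- _ => rename H into HMs end.
    apply Forall_app in HMs as [HMs1 HMs2]; inversion HMs2; subst.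
    apply Forall_app; auto.
Qed.

Lemma reds_scoped D n M N :
  coherent D -> reds D M N -> scoped n M -> scoped n N.
Proof. intros HD; induction 1; eauto using step_scoped. Qed.

(** Renaming creates no redex: a label at the head of the renamed term was already a label
    before. *)
Lemma step_ren_inv D xi M N' :
  coherent D -> step D (ren xi M) N' -> exists N, step D M N /\ N' = ren xi N.
Proof.
  intros HD; revert xi N'; induction M as [x | i | A B IHA IHB | M N IHM IHN | l Ms IH]
    using term_nested_ind; simpl; intros xi N' H; inversion H; subst; clear H.
  - destruct (IHA _ _ ltac:(eassumption)) as (A1 & HA & ->).
    exists (pi A1 B); split; [constructor; assumption | reflexivity].
  - destruct (IHB _ _ ltac:(eassumption)) as (B1 & HB & ->).
    exists (pi A B1); split; [constructor; assumption | reflexivity].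
  - destruct M as [| | | | l Ks]; try discriminate; simpl in *.
    match goal with H : lab _ _ = lab _ _ |- _ => injection H as <- -> end.
    rewrite length_map in *.
    eexists; split; [constructor; eassumption|].
    symmetry; eapply beta_ren; eassumption.
  - destruct (IHM _ _ ltac:(eassumption)) as (M1 & HM & ->).
    exists (app M1 N); split; [constructor; assumption | reflexivity].
  - destruct (IHN _ _ ltac:(eassumption)) as (N1 & HN & ->).
    exists (app M N1); split; [constructor; assumption | reflexivity].
  - match goal with H : _ ++ _ :: _ = map _ _ |- _ => symmetry in H;
      apply map_eq_app in H as (Ms3 & Ms4 & -> & <- & H);
      apply map_eq_cons in H as (M1 & Ms5 & -> & <- & <-) end.
    apply Forall_app in IH as [_ IH]; inversion IH as [|? ? IHM1 _]; subst.
    destruct (IHM1 _ _ ltac:(eassumption)) as (M2 & HM2 & ->).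
    exists (lab l (Ms3 ++ M2 :: Ms5)); split; [constructor; assumption|].
    simpl; rewrite map_app; reflexivity.
Qed.

Lemma reds_ren_inv D xi M N' :
  coherent D -> reds D (ren xi M) N' -> exists N, reds D M N /\ N' = ren xi N.
Proof.
  intros HD H; remember (ren xi M) as M0 eqn:E; revert M E.
  induction H as [M0 | M0 N0 L HM _ IH]; intros M ->.
  - exists M; split; [constructor | reflexivity].
  - apply step_ren_inv in HM as (N & HN & ->); [|assumption].
    destruct (IH N eq_refl) as (L' & HL & ->).
    exists L'; split; [econstructor; eassumption | reflexivity].
Qed.

(** * Confluence *)

(** Parallel reduction in the style of Tait and Martin-Löf. It lies between [step] and [reds] and,
    unlike [step], has the diamond property. *)
Inductive par (D : lctx) : term -> term -> Prop :=
| par_var n : par D (var n) (var n)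
| par_univ i : par D (univ i) (univ i)
| par_pi A A' B B' : par D A A' -> par D B B' -> par D (pi A B) (pi A' B')
| par_app M M' N N' : par D M M' -> par D N N' -> par D (app M N) (app M' N')
| par_lab l Ms Ms' : Forall2 (par D) Ms Ms' -> par D (lab l Ms) (lab l Ms')
| par_beta e Ms Ms' N N' :
    In e D -> length Ms = length (e_tele e) ->
    Forall2 (par D) Ms Ms' -> par D N N' ->
    par D (app (lab (e_name e) Ms) N) (subst (tele_sub (Ms' ++ [N'])) (e_body e)).

Lemma Forall2_diag {A} (R : A -> A -> Prop) l : Forall (fun x => R x x) l -> Forall2 R l l.
Proof. induction 1; constructor; assumption. Qed.

Lemma par_refl D M : par D M M.
Proof.
  induction M using term_nested_ind; constructor; auto.
  apply Forall2_diag; assumption.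
Qed.

Lemma step_par D M N : step D M N -> par D M N.
Proof.
  induction 1; try (constructor; auto using par_refl; fail).
  - constructor; auto using par_refl.
    apply Forall2_diag, Forall_forall; auto using par_refl.
  - constructor; apply Forall2_app; [|constructor; [assumption|]];
      apply Forall2_diag, Forall_forall; auto using par_refl.
Qed.

Lemma par_reds D M N : par D M N -> reds D M N.
Proof.
  revert N; induction M as [x | i | A B IHA IHB | M N IHM IHN | l Ms IH]
    using term_nested_ind; intros L H; inversion H; subst; clear H.
  - constructor.
  - constructor.
  - apply reds_pi; auto.
  - apply reds_app; auto.
  - eapply reds_trans.
    + apply reds_app; [apply IHM; constructor; eassumption | apply IHN; eassumption].
    + apply reds_one; constructor; [assumption|].
      match goal with H : Forall2 _ _ _ |- _ => apply Forall2_length in H end; lia.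
  - apply reds_lab; match goal with H : Forall2 _ _ _ |- _ => induction H end;
      inversion IH; subst; constructor; auto.
Qed.

Lemma par_lab_inv D l Ms N :
  par D (lab l Ms) N -> exists Ms', N = lab l Ms' /\ Forall2 (par D) Ms Ms'.
Proof. inversion 1; subst; eauto. Qed.

Lemma par_subst D sigma tau M N :
  coherent D -> par D M N -> (forall x, par D (sigma x) (tau x)) ->
  par D (subst sigma M) (subst tau N).
Proof.
  intros HD.
  (* Renamings are treated first, because under a [pi] the substitutions are lifted. *)
  assert (Hren : forall xi M N, par D M N -> par D (ren xi M) (ren xi N)).
  { clear M N; intros xi M; revert xi.
    induction M as [x | i | A B IHA IHB | M N IHM IHN | l Ms IH]
      using term_nested_ind; intros xi L H; inversion H; subst; clear H; simpl;
      try (constructor; auto; fail).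
    - erewrite beta_ren; [|eassumption..|].
      + match goal with H : Forall2 _ _ _ |- _ => rename H into HMs end.
        specialize (IHM xi _ (par_lab _ _ _ _ HMs)).
        apply par_lab_inv in IHM as (? & [= <-] & HMs').
        constructor; auto; rewrite length_map; assumption.
      + match goal with H : Forall2 _ _ _ |- _ => apply Forall2_length in H end; lia.
    - constructor; match goal with H : Forall2 _ _ _ |- _ => induction H end;
        inversion IH; subst; constructor; auto. }
  revert sigma tau N; induction M as [x | i | A B IHA IHB | M N IHM IHN | l Ms IH]
    using term_nested_ind; intros sigma tau L H Hst; inversion H; subst; clear H; simpl;
    try (constructor; auto; fail).
  - apply Hst.
  - constructor; [auto|]; apply IHB; [assumption|].
    intros [|x]; simpl; [constructor | apply Hren, Hst].
  - erewrite beta_subst; [|eassumption..|].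
    + match goal with H : Forall2 _ _ _ |- _ => rename H into HMs end.
      (* The head of the redex is itself a label; its hypothesis yields the parallel steps between
         the captured terms. *)
      specialize (IHM _ _ _ (par_lab _ _ _ _ HMs) Hst).
      apply par_lab_inv in IHM as (? & [= <-] & HMs').
      constructor; auto; rewrite length_map; assumption.
    + match goal with H : Forall2 _ _ _ |- _ => apply Forall2_length in H end; lia.
  - constructor; match goal with H : Forall2 _ _ _ |- _ => induction H end;
      inversion IH; subst; constructor; auto.
Qed.

Lemma par_tele_sub D Ms Ms' :
  Forall2 (par D) Ms Ms' -> forall x, par D (tele_sub Ms x) (tele_sub Ms' x).
Proof.
  intros H x; unfold tele_sub; rewrite <- (Forall2_length H).
  destruct (x <? length Ms); [|constructor].
  generalize (length Ms - 1 - x); induction H; intros [|k]; simpl; auto; constructor.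
Qed.

(** Steps overlap nontrivially only at a label applied to an argument. There the hypothesis for the
    head joins the captured terms, and [par_subst] carries the joined terms into the body. *)
Lemma par_diamond D M N1 N2 :
  coherent D -> par D M N1 -> par D M N2 -> exists L, par D N1 L /\ par D N2 L.
Proof.
  intros HD; revert N1 N2;
    induction M as [x | i | A B IHA IHB | M N IHM IHN | l Ms IH]
    using term_nested_ind; intros N1 N2 H1 H2.
  - inversion H1; inversion H2; subst; eauto using par_refl.
  - inversion H1; inversion H2; subst; eauto using par_refl.
  - inversion H1 as [| |? A1 ? B1 HA1 HB1| | |]; inversion H2 as [| |? A2 ? B2 HA2 HB2| | |]; subst.
    destruct (IHA _ _ HA1 HA2) as (A3 & ? & ?), (IHB _ _ HB1 HB2) as (B3 & ? & ?).
    exists (pi A3 B3); split; constructor; assumption.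
  - inversion H1 as [| | |? M1 ? L1 HM1 HL1| |e1 Ms0 Ms1 ? L1 He1 Hlen1 HMs1 HL1];
      inversion H2 as [| | |? M2 ? L2 HM2 HL2| |e2 Ms0' Ms2 ? L2 He2 Hlen2 HMs2 HL2]; subst;
      destruct (IHN _ _ HL1 HL2) as (L3 & HL13 & HL23).
    + destruct (IHM _ _ HM1 HM2) as (M3 & ? & ?).
      exists (app M3 L3); split; constructor; assumption.
    + destruct (IHM _ _ HM1 (par_lab _ _ _ _ HMs2)) as (M3 & HM13 & HM23).
      apply par_lab_inv in HM1 as (Ms1 & -> & HMs1).
      apply par_lab_inv in HM13 as (Ms3 & -> & HMs13).
      apply par_lab_inv in HM23 as (? & [= <-] & HMs23).
      exists (subst (tele_sub (Ms3 ++ [L3])) (e_body e2)); split.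
      * apply par_beta; try eassumption. apply Forall2_length in HMs1; lia.
      * apply par_subst, par_tele_sub, Forall2_app; auto using par_refl.
    + destruct (IHM _ _ HM2 (par_lab _ _ _ _ HMs1)) as (M3 & HM23 & HM13).
      apply par_lab_inv in HM2 as (Ms2 & -> & HMs2).
      apply par_lab_inv in HM23 as (Ms3 & -> & HMs23).
      apply par_lab_inv in HM13 as (? & [= <-] & HMs13).
      exists (subst (tele_sub (Ms3 ++ [L3])) (e_body e1)); split.
      * apply par_subst, par_tele_sub, Forall2_app; auto using par_refl.
      * apply par_beta; try eassumption. apply Forall2_length in HMs2; lia.
    + match goal with H : lab _ _ = lab _ _ |- _ => injection H as Hname -> end.
      (* Names determine entries, so both contractions use the same body. *)
      apply (name_inj _ HD) in Hname; [subst e2|assumption..].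
      destruct (IHM _ _ (par_lab _ _ _ _ HMs1) (par_lab _ _ _ _ HMs2)) as (M3 & HM13 & HM23).
      apply par_lab_inv in HM13 as (Ms3 & -> & HMs13).
      apply par_lab_inv in HM23 as (? & [= <-] & HMs23).
      exists (subst (tele_sub (Ms3 ++ [L3])) (e_body e1)); split; apply par_subst, par_tele_sub, Forall2_app; auto using par_refl.
  - apply par_lab_inv in H1 as (Ms1 & -> & H1).
    apply par_lab_inv in H2 as (Ms2 & -> & H2).
    enough (exists Ms3, Forall2 (par D) Ms1 Ms3 /\ Forall2 (par D) Ms2 Ms3)
      as (Ms3 & ? & ?) by (exists (lab l Ms3); split; constructor; assumption).
    revert Ms1 Ms2 H1 H2; induction IH as [|M Ms HM _ IHMs]; intros Ms1 Ms2 H1 H2;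
      inversion H1 as [|? M1 ? Ms1' HM1 HMs1]; inversion H2 as [|? M2 ? Ms2' HM2 HMs2]; subst.
    + exists []; split; constructor.
    + destruct (HM _ _ HM1 HM2) as (M3 & ? & ?), (IHMs _ _ HMs1 HMs2) as (Ms3 & ? & ?).
      exists (M3 :: Ms3); split; constructor; assumption.
Qed.

Lemma confluence D M N1 N2 :
  coherent D -> reds D M N1 -> reds D M N2 -> exists L, reds D N1 L /\ reds D N2 L.
Proof.
  intros HD H1 H2.
  (* Strip lemma: one parallel step is joined with a whole reduction sequence by pushing it along
     the sequence. *)
  assert (strip : forall M M' N, par D M M' -> reds D M N ->
            exists L, reds D M' L /\ par D N L).
  { clear - HD; intros M M' N HM H; revert M' HM.
    induction H as [M | M M1 N H1 _ IH]; intros M' HM.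
    - exists M'; split; [constructor | assumption].
    - destruct (par_diamond _ _ _ _ HD HM (step_par _ _ _ H1)) as (M2 & HM2 & HM12).
      destruct (IH _ HM12) as (L & HL & HNL).
      exists L; split; [|assumption].
      eapply reds_trans; [apply par_reds; eassumption | assumption]. }
  revert N2 H2; induction H1 as [M | M M1 N1 H _ IH]; intros N2 H2.
  - exists N2; split; [assumption | constructor].
  - destruct (strip _ _ _ (step_par _ _ _ H) H2) as (L & HL & HN2).
    destruct (IH _ HL) as (L' & HL' & HLL').
    exists L'; split; [assumption|].
    eapply reds_trans; [apply par_reds; eassumption | assumption].
Qed.

(** * Normalizing terms *)

Fixpoint var_headed (M : term) : Prop :=
  match M with
  | var _ => True
  | app M _ => var_headed M
  | _ => False
  end.

Definition neutral (D : lctx) (v : term) : Prop := irreducible D v /\ var_headed v.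

(** The second conjunct excludes irreducible terms that are stuck, such as [app (univ i) N]. *)
Definition normal (D : lctx) (v : term) : Prop :=
  irreducible D v /\ (value v \/ var_headed v).

Definition wn (D : lctx) (M : term) : Prop := exists v, reds D M v /\ normal D v.

Definition wne (D : lctx) (M : term) : Prop := exists v, reds D M v /\ neutral D v.

Lemma irreducible_reds D M N : irreducible D M -> reds D M N -> N = M.
Proof. intros HM H; destruct H as [|M N L H _]; [reflexivity | elim (HM _ H)]. Qed.

Lemma reds_wn D M N : reds D M N -> wn D N -> wn D M.
Proof. intros H (v & Hv & Hn); exists v; split; [eapply reds_trans|]; eassumption. Qed.

Lemma reds_wne D M N : reds D M N -> wne D N -> wne D M.
Proof. intros H (v & Hv & Hn); exists v; split; [eapply reds_trans|]; eassumption. Qed.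

Lemma wne_wn D M : wne D M -> wn D M.
Proof. intros (v & Hv & Hi & Hh); exists v; repeat split; auto. Qed.

Lemma wne_var D n : wne D (var n).
Proof. exists (var n); repeat split; [constructor|]; intros M H; inversion H. Qed.

Lemma wne_app D M N : wne D M -> wn D N -> wne D (app M N).
Proof.
  intros (v & Hv & Hvi & Hvh) (w & Hw & Hwi & _).
  exists (app v w); split; [apply reds_app; assumption|]; split; [|exact Hvh].
  intros L H; inversion H; subst; [contradiction Hvh | eapply Hvi | eapply Hwi]; eassumption.
Qed.

Lemma wn_univ D i : wn D (univ i).
Proof.
  exists (univ i); repeat split; [constructor | | left; constructor].
  intros M H; inversion H.
Qed.

Lemma wn_pi D A B : wn D A -> wn D B -> wn D (pi A B).
Proof.
  intros (v & Hv & Hvi & _) (w & Hw & Hwi & _).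
  exists (pi v w); split; [apply reds_pi; assumption|]; split; [|left; constructor].
  intros L H; inversion H; subst; [eapply Hvi | eapply Hwi]; eassumption.
Qed.

Lemma wn_lab D l Ms : Forall (wn D) Ms -> wn D (lab l Ms).
Proof.
  intros HMs.
  assert (H : exists vs, Forall2 (reds D) Ms vs /\ Forall (irreducible D) vs).
  { induction HMs as [|M Ms (v & Hv & Hvi & _) _ (vs & Hvs & Hvsi)].
    - exists []; split; constructor.
    - exists (v :: vs); split; constructor; assumption. }
  destruct H as (vs & Hvs & Hvsi).
  exists (lab l vs); split; [apply reds_lab; assumption|]; split; [|left; constructor].
  intros L H; inversion H; subst.
  apply Forall_app in Hvsi as [_ Hvsi]; inversion Hvsi as [|? ? Hi _]; eapply Hi; eassumption.
Qed.

Lemma step_ren D xi M N : coherent D -> step D M N -> step D (ren xi M) (ren xi N).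
Proof. intros HD H; rewrite !ren_as_subst; apply step_subst; assumption. Qed.

(** Reductions of a renamed term come from the term itself, and renaming preserves steps, so a
    normal form is reflected. This recovers normalization under a binder from an instance at a
    variable. *)
Lemma wn_ren_inv D xi M : coherent D -> wn D (ren xi M) -> wn D M.
Proof.
  intros HD (v' & Hv & Hi & Hh).
  apply reds_ren_inv in Hv as (v & Hv & ->); [|assumption].
  exists v; split; [assumption|]; split.
  - intros L H; apply (Hi (ren xi L)), step_ren; assumption.
  - destruct Hh as [Hh|Hh].
    + left; destruct v; inversion Hh; constructor.
    + right; clear - Hh; induction v; simpl in *; auto.
Qed.

Lemma reds_pi_inv D A B X :
  reds D (pi A B) X -> exists A' B', X = pi A' B' /\ reds D A A' /\ reds D B B'.
Proof.
  intros H; remember (pi A B) as M eqn:E; revert A B E.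
  induction H as [M | M N L H _ IH]; intros A B ->.
  - exists A, B; repeat split; constructor.
  - inversion H; subst; destruct (IH _ _ eq_refl) as (A1 & B1 & -> & HA & HB);
      exists A1, B1; repeat split; auto; econstructor; eassumption.
Qed.

(** * The logical relation *)

(* A label can have a normalizing application without being normalizing itself,
   since the body may discard the captured arguments; hence the conjunct [wn]. *)
Definition prod_space (D : lctx) (PA : term -> Prop) (PF : term -> term -> Prop)
  (f : term) : Prop :=
  wn D f /\ forall a, PA a -> PF a (app f a).

(* Sets of the universes [U_j], [j < i], are given by [I]. *)
Inductive interp_with (D : lctx) (i : nat) (I : nat -> term -> Prop) :
  term -> (term -> Prop) -> Prop :=
| int_ne A : neutral D A -> interp_with D i I A (wne D)
| int_pi A B PA PF :
    interp_with D i I A PA ->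
    (forall a, PA a -> interp_with D i I (subst (subst1 a) B) (PF a)) ->
    interp_with D i I (pi A B) (prod_space D PA PF)
| int_univ j : j < i -> interp_with D i I (univ j) (I j)
| int_step A A' P :
    step D A A' -> interp_with D i I A' P -> interp_with D i I A P.

(** A table of the sets denoted by [U_j] for [j < i]. Building it by structural recursion on the
    bound [i] lets each level refer to the levels below. *)
Fixpoint universe (D : lctx) (i j : nat) (A : term) : Prop :=
  match i with
  | 0 => False
  | S i' => if j =? i' then exists P, interp_with D i' (universe D i') A P
            else universe D i' j A
  end.

Definition interp (D : lctx) (i : nat) : term -> (term -> Prop) -> Prop :=
  interp_with D i (universe D i).

Lemma universe_lt D i j :
  j < i -> universe D i j = (fun A => exists P, interp D j A P).
Proof.
  induction i as [|i IH]; intros Hj; [lia|].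
  extensionality A; simpl; destruct (Nat.eqb_spec j i) as [->|Hne]; [reflexivity|].
  rewrite IH by lia; reflexivity.
Qed.

(** The level enters only through the universe clause, and by [universe_lt] the tables of both
    levels agree there. *)
Lemma interp_cumul D i k A P : i <= k -> interp D i A P -> interp D k A P.
Proof.
  intros Hik H; unfold interp in *.
  induction H as [A HA | A B PA PF _ IHA _ IHB | j Hj | A A' P HA _ IH].
  - apply int_ne; assumption.
  - apply int_pi; assumption.
  - rewrite universe_lt, <- (universe_lt D k j) by lia; apply int_univ; lia.
  - eapply int_step; eassumption.
Qed.

Lemma interp_expand D i A A' P : reds D A A' -> interp D i A' P -> interp D i A P.
Proof.
  induction 1 as [|A A0 A' HA _ IH]; intros HP; [assumption|].
  eapply int_step; [eassumption | exact (IH HP)].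
Qed.

(** Only the expansion clause is delicate: confluence joins its step with the given reduction, the
    hypothesis interprets the common reduct, and expansion leads back to [A']. *)
Lemma interp_reduce D i A A' P :
  coherent D -> reds D A A' -> interp D i A P -> interp D i A' P.
Proof.
  intros HD HA H; unfold interp in *; revert A' HA.
  induction H as [A HA | A B PA PF _ IHA _ IHB | j Hj | A A0 P HA0 _ IH]; intros A' HA'.
  - apply irreducible_reds in HA' as ->; [|apply HA]; apply int_ne; assumption.
  - apply reds_pi_inv in HA' as (A1 & B1 & -> & HA & HB).
    apply int_pi; [auto|].
    intros a Ha; apply IHB; [assumption|]; apply reds_subst; assumption.
  - apply irreducible_reds in HA' as ->; [apply int_univ; assumption|].
    intros M H; inversion H.
  - destruct (confluence _ _ _ _ HD (reds_one _ _ _ HA0) HA') as (L & HL & HL').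
    eapply interp_expand; [eassumption | apply IH; assumption].
Qed.

Lemma interp_neutral_inv D i A P : neutral D A -> interp D i A P -> P = wne D.
Proof.
  intros [Hi Hh] H; inversion H as [ | | | ? ? ? Hstep]; subst;
    [reflexivity | contradiction Hh | contradiction Hh | elim (Hi _ Hstep)].
Qed.

Lemma interp_univ_inv D i j P :
  interp D i (univ j) P -> j < i /\ P = (fun A => exists P, interp D j A P).
Proof.
  inversion 1 as [? [_ Hh] | | ? Hj | ? ? ? Hstep]; subst.
  - contradiction Hh.
  - split; [|apply universe_lt]; assumption.
  - inversion Hstep.
Qed.

(** A label reduces only to labels, and no clause other than expansion applies to one. *)
Lemma lab_not_interp D i l Ms P : ~ interp D i (lab l Ms) P.
Proof.
  intros H; remember (lab l Ms) as A eqn:E; revert Ms E.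
  induction H as [A HA | A B PA PF _ IHA _ IHB | j Hj | A A0 P HA0 _ IH];
    intros Ms E; try discriminate; subst.
  - destruct HA as [_ []].
  - inversion HA0; subst; eapply IH; reflexivity.
Qed.

(** Expansion may have been used at the [pi] itself, but every step of a [pi] takes place in one
    component and can be undone there. *)
Lemma interp_pi_inv D i A B P :
  coherent D -> interp D i (pi A B) P ->
  exists PA PF, interp D i A PA /\
    (forall a, PA a -> interp D i (subst (subst1 a) B) (PF a)) /\
    P = prod_space D PA PF.
Proof.
  intros HD H; remember (pi A B) as C eqn:E; revert A B E.
  induction H as [C HC | A0 B0 PA PF HA _ HB _ | j Hj | C C' P HC _ IH];
    intros A B E; try discriminate.
  - subst; destruct HC as [_ []].
  - injection E as -> ->; exists PA, PF; auto.
  - subst; inversion HC; subst;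
      destruct (IH _ _ eq_refl) as (PA & PF & HA & HB & ->);
      exists PA, PF; repeat split; try assumption.
    + eapply int_step; eassumption.
    + intros a Ha; eapply int_step; [apply step_subst; eassumption|]; apply HB, Ha.
Qed.

(** Two families [PF] may differ outside [PA]; [prod_space] consults them only on [PA], so
    extensionality identifies the products. *)
Lemma interp_level_functional D i A P Q :
  coherent D -> interp D i A P -> interp D i A Q -> P = Q.
Proof.
  intros HD H; revert Q; unfold interp in H.
  induction H as [A HA | A B PA PF _ IHA _ IHB | j Hj | A A0 P HA0 _ IH]; intros Q HQ.
  - symmetry; eapply interp_neutral_inv; eassumption.
  - apply interp_pi_inv in HQ as (PA' & PF' & HA & HB & ->); [|assumption].
    apply IHA in HA as <-.
    extensionality f; apply propositional_extensionality.
    split; intros [Hf Happ]; (split; [assumption|]); intros a Ha.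
    + rewrite <- (IHB a Ha _ (HB a Ha)); auto.
    + rewrite (IHB a Ha _ (HB a Ha)); auto.
  - apply interp_univ_inv in HQ as [_ ->]; apply universe_lt; assumption.
  - apply IH; eapply interp_reduce; [|apply reds_one|]; eassumption.
Qed.

Lemma interp_functional D i j A P Q :
  coherent D -> interp D i A P -> interp D j A Q -> P = Q.
Proof.
  intros HD HP HQ; apply interp_level_functional with D (max i j) A; [assumption|..];
    eapply interp_cumul; [|eassumption| |eassumption]; lia.
Qed.

(** * Closure properties and adequacy of the interpretation *)

Lemma interp_member_expand D i A P M N :
  interp D i A P -> reds D M N -> P N -> P M.
Proof.
  intros H; revert M N; unfold interp in H.
  induction H as [A HA | A B PA PF _ _ _ IHB | j Hj | A A0 P _ _ IH]; intros M N HMN HN.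
  - eapply reds_wne; eassumption.
  - destruct HN as [Hwn Happ]; split; [eapply reds_wn; eassumption|].
    intros a Ha; eapply IHB; [assumption | | apply Happ; assumption].
    apply reds_app; [assumption | constructor].
  - rewrite universe_lt in * by assumption; destruct HN as [P HP].
    exists P; eapply interp_expand; eassumption.
  - eapply IH; eassumption.
Qed.

(** The reducibility conditions: sets lie between [wne] and [wn], and types normalize. The members
    of a universe are types of a lower level, hence the outer induction on the level. *)
Lemma interp_adequate D i A P :
  coherent D -> interp D i A P ->
  wn D A /\ (forall M, P M -> wn D M) /\ (forall M, wne D M -> P M).
Proof.
  intros HD; revert A P; induction i as [i IHi] using lt_wf_ind.
  intros A P H; unfold interp in H.
  induction H as [A HA | A B PA PF _ IHA _ IHB | j Hj | A A0 P HA0 _ IH].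
  - repeat split; auto using wne_wn.
    apply wne_wn; exists A; split; [constructor | assumption].
  - destruct IHA as (HA & HPA & HPA').
    repeat split.
    + apply wn_pi; [assumption|].
      (* A variable lies in every set, so the codomain can be instantiated at [var 0]; this instance
         is the renaming of [B] by [pred]. *)
      destruct (IHB (var 0)) as [HB _]; [apply HPA', wne_var|].
      apply wn_ren_inv with (xi := fun n => pred n); [assumption|].
      rewrite ren_as_subst.
      replace (fun n => var (pred n)) with (subst1 (var 0)); [assumption|].
      extensionality n; destruct n; reflexivity.
    + intros M [HM _]; assumption.
    + apply wne_wn; assumption.
    + intros a Ha; apply IHB; [assumption|].
      apply wne_app; [assumption | apply HPA, Ha].
  - rewrite universe_lt by assumption; repeat split.
    + apply wn_univ.
    + intros M [P HP]; exact (proj1 (IHi j Hj M P HP)).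
    + intros M (v & Hv & Hn); exists (wne D).
      eapply interp_expand; [eassumption|]; apply int_ne; assumption.
  - destruct IH as [HA IH]; split; [|assumption].
    eapply reds_wn; [apply reds_one|]; eassumption.
Qed.

(** The family is obtained without choice: by functionality, the union of all interpretations of an
    instance is its only interpretation. *)
Lemma interp_pi_intro D i A B PA :
  coherent D -> interp D i A PA ->
  (forall a, PA a -> exists P, interp D i (subst (subst1 a) B) P) ->
  exists P, interp D i (pi A B) P.
Proof.
  intros HD HA HB.
  exists (prod_space D PA (fun a b => exists P, interp D i (subst (subst1 a) B) P /\ P b)).
  apply int_pi; [assumption|].
  intros a Ha; destruct (HB a Ha) as [P HP].
  replace (fun b => _) with P; [assumption|].
  extensionality b; apply propositional_extensionality; split; [eauto|].
  intros (Q & HQ & Hb); rewrite (interp_functional _ _ _ _ _ _ HD HP HQ); assumption.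
Qed.

Lemma step_incl D E M N : incl D E -> step D M N -> step E M N.
Proof. intros HDE; induction 1; constructor; auto. Qed.

Lemma reds_incl D E M N : incl D E -> reds D M N -> reds E M N.
Proof. intros HDE; induction 1; econstructor; eauto using step_incl. Qed.

(* The eta clauses of [equiv] never relate two types, as labels are not types. *)
Lemma interp_equiv D E i j rho A B P Q :
  coherent E -> incl D E -> equiv D A B ->
  interp E i (subst rho A) P -> interp E j (subst rho B) Q -> P = Q.
Proof.
  intros HE HDE Heq HP HQ.
  assert (Hred : forall k M N R, reds D M N ->
            interp E k (subst rho M) R -> interp E k (subst rho N) R).
  { intros k M N R H; apply interp_reduce; [assumption|].
    apply reds_subst; [|eapply reds_incl]; eassumption. }
  destruct Heq as [A B L HA HB | A B Ns B' e HA | B A Ns A' e HB].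
  - exact (interp_functional _ _ _ _ _ _ HE (Hred _ _ _ _ HA HP) (Hred _ _ _ _ HB HQ)).
  - elim (lab_not_interp _ _ _ _ _ (Hred _ _ _ _ HA HP)).
  - elim (lab_not_interp _ _ _ _ _ (Hred _ _ _ _ HB HQ)).
Qed.

(** * Scoping of typed terms *)

Scheme has_type_mut := Minimality for has_type Sort Prop
  with wf_mut := Minimality for wf Sort Prop.
Combined Scheme typing_mut from has_type_mut, wf_mut.

(** Entry [n] is stored unshifted, over the older bindings only. *)
Definition ctx_scoped (G : ctx) : Prop :=
  forall n A, nth_error G n = Some A -> scoped (length G - S n) A.

Lemma nth_error_rev_tele (As : list term) k :
  k < length As ->
  nth_error (rev As) k = Some (nth (length As - S k) As (var 0)).
Proof.
  intros Hk; rewrite nth_error_rev; apply Nat.ltb_lt in Hk as Hk'; rewrite Hk'.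
  apply nth_error_nth'; lia.
Qed.

Lemma nth_rev_tele (As : list term) n A :
  nth_error (rev As) n = Some A ->
  n < length As /\ A = nth (length As - S n) As (var 0).
Proof.
  intros H; assert (Hn : n < length As).
  { rewrite <- length_rev; apply nth_error_Some; rewrite H; discriminate. }
  rewrite nth_error_rev_tele in H by assumption; injection H; auto.
Qed.

Lemma typing_scoped :
  (forall D G M A, has_type D G M A ->
     scoped (length G) M /\ ctx_scoped G /\ coherent D) /\
  (forall D G, wf D G -> ctx_scoped G /\ coherent D).
Proof.
  apply typing_mut.
  - intros D G n A Hn _ [HG HD]; repeat split; try apply HD; try assumption.
    constructor; apply nth_error_Some; rewrite Hn; discriminate.
  - intros D G i _ [HG HD]; repeat split; try apply HD; try assumption; constructor.
  - intros D G A B i j _ (HA & HG & HD) _ (HB & _); repeat split; try apply HD; try assumption.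
    constructor; assumption.
  - intros D G M N A B _ (HM & HG & HD) _ (HN & _); repeat split; try apply HD; try assumption.
    constructor; assumption.
  - auto.
  - intros D G e Ms _ [HG HD] He Hlen _ IH; repeat split; try apply HD; try assumption.
    constructor; apply Forall_forall; intros M HM.
    apply In_nth with (d := var 0) in HM as (k & Hk & <-); apply IH, Hk.
  - split; [|split; contradiction].
    intros [|n] A; discriminate.
  - intros D e i Hfresh _ (Hpi & Htele & HD) _ (Hbody & Hctx & _).
    simpl in *; rewrite length_rev in *.
    split; [intros [|n] A; discriminate|]; split.
    + intros e' [<-|He']; [|apply HD, He'].
      inversion Hpi; subst; split; try assumption.
      intros k Hk.
      (* The telescope starts with its oldest type and the context with its newest, so type [k] has
         index [length (e_tele e) - S k]. *)
      replace k with (length (e_tele e) - S (length (e_tele e) - S k)) at 2 by lia.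
      replace k with (length (rev (e_tele e)) - S (length (e_tele e) - S k)) at 1
        by (rewrite length_rev; lia).
      apply Htele; rewrite nth_error_rev_tele by lia; reflexivity.
    + intros e1 e2 [<-|He1] [<-|He2] Heq; [reflexivity|..].
      * elim (Hfresh e2); auto.
      * elim (Hfresh e1); auto.
      * eapply name_inj; eassumption.
  - intros D G A i _ [HG HD] _ (HA & _); split; [|assumption].
    intros [|n] B HB; simpl in *.
    + injection HB as <-; rewrite Nat.sub_0_r; assumption.
    + apply HG; assumption.
Qed.

(** * Semantic typing *)

(** Each variable has its own level; [interp_functional] makes the set independent of that
    choice. *)
Definition sem_env (D : lctx) (G : ctx) (rho : nat -> term) : Prop :=
  forall n A, nth_error G n = Some A ->
  exists i P, interp D i (subst rho (ren (Nat.add (S n)) A)) P /\ P (rho n).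

Definition sem_type (D : lctx) (G : ctx) (M A : term) : Prop :=
  forall rho, sem_env D G rho ->
  exists i P, interp D i (subst rho A) P /\ P (subst rho M).

(** The semantic reading of the two typing premises under which an entry is added. *)
Definition sem_entry (D : lctx) (e : entry) : Prop :=
  (exists i, sem_type D (rev (e_tele e)) (pi (e_arg e) (e_res e)) (univ i)) /\
  sem_type D (e_arg e :: rev (e_tele e)) (e_body e) (e_res e).

Lemma sem_env_cons D G rho A i P a :
  sem_env D G rho -> interp D i (subst rho A) P -> P a ->
  sem_env D (A :: G) (scons a rho).
Proof.
  intros Hrho HP Ha [|n] B HB; simpl in HB.
  - injection HB as <-; exists i, P; split; [|assumption].
    rewrite subst_ren; assumption.
  - destruct (Hrho n B HB) as (j & Q & HQ & Hn); exists j, Q; split; [|assumption].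
    rewrite subst_ren in *; assumption.
Qed.

Lemma sem_type_univ D G A i rho :
  sem_type D G A (univ i) -> sem_env D G rho -> exists P, interp D i (subst rho A) P.
Proof.
  intros HA Hrho; destruct (HA rho Hrho) as (k & P & HP & HPA).
  apply interp_univ_inv in HP as [_ ->]; assumption.
Qed.

Lemma sem_env_tele_sub D Ms (As : list term) :
  length Ms = length As ->
  (forall k, k < length As -> scoped k (nth k As (var 0))) ->
  (forall k, k < length Ms -> exists i P,
     interp D i (subst (tele_sub (firstn k Ms)) (nth k As (var 0))) P /\
     P (nth k Ms (var 0))) ->
  sem_env D (rev As) (tele_sub Ms).
Proof.
  intros Hlen Hsc HMs n A HA.
  apply nth_rev_tele in HA as [Hn ->].
  destruct (HMs (length As - S n)) as (i & P & HP & Hk); [lia|].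
  exists i, P; split.
  - rewrite subst_ren; erewrite subst_scoped_ext; [exact HP | apply Hsc; lia|].
    (* On the variables older than index [n], the full substitution shifted by [S n] and the
       substitution of the prefix agree. *)
    intros x Hx; simpl.
    rewrite !tele_sub_lt by (rewrite ?length_firstn; lia).
    rewrite length_firstn, nth_firstn.
    replace (_ <? _) with true by (symmetry; apply Nat.ltb_lt; lia).
    f_equal; lia.
  - rewrite tele_sub_lt by lia.
    replace (length Ms - 1 - n) with (length As - S n) by lia; assumption.
Qed.

(** Applied to [a], the label takes one step to its body in the environment extended by [a].
    Validity of the entry places this instance in the required set, which is closed under
    expansion. *)
Lemma sem_lab D e Ms :
  coherent D -> In e D -> sem_entry D e ->
  length Ms = length (e_tele e) -> Forall (wn D) Ms ->
  sem_env D (rev (e_tele e)) (tele_sub Ms) ->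
  exists i P,
    interp D i (subst (tele_sub Ms) (pi (e_arg e) (e_res e))) P /\ P (lab (e_name e) Ms).
Proof.
  intros HD He [[i Hpi] Hbody] Hlen Hwn Henv.
  destruct (sem_type_univ _ _ _ _ _ Hpi Henv) as [P HP]; exists i, P; split; [assumption|].
  apply interp_pi_inv in HP as (PA & PF & HA & HB & ->); [|assumption].
  split; [apply wn_lab; assumption|].
  intros a Ha; specialize (HB a Ha).
  destruct (Hbody (scons a (tele_sub Ms))) as (j & Q & HQ & Hb);
    [eapply sem_env_cons; eassumption|].
  rewrite subst1_up in HB.
  rewrite (interp_functional _ _ _ _ _ _ HD HB HQ).
  eapply interp_member_expand; [eassumption | | eassumption].
  erewrite subst_scoped_ext;
    [apply reds_one, st_beta; eassumption | apply body_scoped, HD; assumption |].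
  intros x Hx; symmetry; apply tele_sub_snoc; lia.
Qed.

(* Types are validated in a fixed final label context [E], so that the
   entries of [D] need not be re-typed when labels are added. *)
Lemma fundamental E :
  coherent E ->
  (forall D G M A, has_type D G M A -> incl D E ->
     sem_type E G M A /\ forall e, In e D -> sem_entry E e) /\
  (forall D G, wf D G -> incl D E -> forall e, In e D -> sem_entry E e).
Proof.
  intros HE; apply typing_mut.
  - intros D G n A Hn _ IH HDE; split; [|auto].
    intros rho Hrho; apply (Hrho n A Hn).
  - intros D G i _ IH HDE; split; [|auto].
    (* [U_{i+1}] is interpreted from level [i+2] on, and [U_i] belongs to it because it is
       interpreted at level [i+1]. *)
    intros rho Hrho; exists (S (S i)); eexists; split; [apply int_univ; lia|].
    rewrite universe_lt by lia; eexists; apply int_univ; lia.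
  - intros D G A B i j _ IHA _ IHB HDE; split; [|apply IHA; assumption].
    intros rho Hrho; exists (S (max i j)); eexists; split; [apply int_univ; lia|].
    rewrite universe_lt by lia; simpl.
    destruct (sem_type_univ _ _ _ _ _ (proj1 (IHA HDE)) Hrho) as [PA HA].
    apply interp_pi_intro with PA; [assumption | eapply interp_cumul; [|eassumption]; lia|].
    intros a Ha; rewrite subst1_up.
    destruct (sem_type_univ _ _ _ _ (scons a rho) (proj1 (IHB HDE))) as [PB HB];
      [eapply sem_env_cons; eassumption|].
    exists PB; eapply interp_cumul; [|eassumption]; lia.
  - intros D G M N A B _ IHM _ IHN HDE; split; [|apply IHM; assumption].
    intros rho Hrho.
    destruct (proj1 (IHM HDE) rho Hrho) as (i & P & HP & HM).
    destruct (proj1 (IHN HDE) rho Hrho) as (j & Q & HQ & HN).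
    apply interp_pi_inv in HP as (PA & PF & HA & HB & ->); [|assumption].
    rewrite (interp_functional _ _ _ _ _ _ HE HQ HA) in HN.
    exists i, (PF (subst rho N)); split; [|apply HM; assumption].
    rewrite subst_subst1, <- subst1_up; auto.
  - intros D G M A B i _ IHM Heq _ IHB HDE; split; [|apply IHM; assumption].
    intros rho Hrho.
    destruct (proj1 (IHM HDE) rho Hrho) as (k & P & HP & HM).
    destruct (sem_type_univ _ _ _ _ _ (proj1 (IHB HDE)) Hrho) as [Q HQ].
    exists i, Q; split; [assumption|].
    replace Q with P; [assumption|].
    eapply interp_equiv; eassumption.
  - intros D G e Ms _ IH He Hlen _ IHMs HDE; split; [|auto].
    intros rho Hrho.
    assert (HeE : In e E) by auto.
    pose proof (entries_scoped _ HE e HeE) as Hsc.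
    (* Entries are closed, so [rho] acts only on the captured terms, and instantiating the telescope
       commutes with it. *)
    destruct (sem_lab E e (map (subst rho) Ms)) as (i & P & HP & Hlab); auto.
    + rewrite length_map; assumption.
    + apply Forall_map, Forall_forall; intros M HM.
      apply In_nth with (d := var 0) in HM as (k & Hk & <-).
      destruct (proj1 (IHMs k Hk HDE) rho Hrho) as (i & P & HP & HM).
      apply interp_adequate in HP as (_ & HP & _); auto.
    + apply sem_env_tele_sub.
      * rewrite length_map; assumption.
      * apply Hsc.
      * rewrite length_map; intros k Hk.
        destruct (proj1 (IHMs k Hk HDE) rho Hrho) as (i & P & HP & HM).
        exists i, P; split.
        -- erewrite subst_tele_sub in HP; [|apply Hsc; lia | rewrite length_firstn; lia].
           rewrite firstn_map; assumption.
        -- rewrite nth_indep with (d' := subst rho (var 0)), map_nth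
             by (rewrite length_map; assumption); assumption.
    + exists i, P; split; [|assumption].
      erewrite subst_tele_sub with (Ms := Ms) (t := pi (e_arg e) (e_res e));
        [exact HP | constructor; apply Hsc | assumption].
  - intros _ e [].
  (* The premises are derivations over the older context [D], also included in [E]; their hypotheses
     are exactly the validity of the new entry in [E]. *)
  - intros D e i _ _ IHpi _ IHbody HDE e' [<-|He'].
    + apply incl_cons_inv in HDE as [_ HDE].
      destruct (IHpi HDE) as [Hpi _], (IHbody HDE) as [Hbody _].
      split; [exists i|]; assumption.
    + apply incl_cons_inv in HDE as [_ HDE]; apply IHpi; assumption.
  - auto.
Qed.

(** * Closed terms reduce to values *)

Theorem theorem3p23 : forall (D : lctx) (M A : term),
  has_type D [] M A ->
  exists v, reds D M v /\ value v /\ irreducible D v.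
Proof.
  intros D M A HM.
  destruct (proj1 typing_scoped _ _ _ _ HM) as (Hsc & _ & HD).
  (* The final label context is [D] itself, and the identity substitution is an environment for the
     empty context. *)
  destruct (proj1 (proj1 (fundamental D HD) _ _ _ _ HM (incl_refl D)) var)
    as (i & P & HP & HPM).
  { intros [|n] B; discriminate. }
  rewrite subst_var in HPM.
  apply interp_adequate in HP as (_ & HP & _); [|assumption].
  destruct (HP M HPM) as (v & Hv & Hi & Hh).
  exists v; repeat split; try assumption.
  destruct Hh as [|Hh]; [assumption|]; exfalso.
  (* Reduction keeps the term closed, so no variable can stand at its head. *)
  apply (reds_scoped _ _ _ _ HD Hv) in Hsc; simpl in Hsc.
  clear - Hsc Hh; induction v; simpl in Hh; try contradiction; inversion Hsc; subst; [lia | auto].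
Qed.
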